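(* Let $D$ be an MPD domain with $|\operatorname{Max}(D)|=n<\infty$. Then: (a) $|\mathcal{O}(D)|=2^{n}$ or $3\cdot 2^{n-1}$; (b) $|\mathcal{O}_{ql}(D)|=n+2$ or $n+1$.
   Context: All rings are commutative unitary integral domains. A ring is quasi-local if it has exactly one maximal ideal (no Noetherian assumption). For an integral domain $D$ with quotient field $K$, an overring of $D$ is a subring of $K$ containing $D$; $\mathcal{O}(D)$ is the set of all overrings of $D$ and $\mathcal{O}_{ql}(D)$ is the set of those overrings of $D$ which are quasi-local. $\operatorname{Max}(D)$ is the set of maximal ideals of $D$. An MNI ideal of $D$ is an ideal of $D$ which is maximal (under inclusion) among the non-invertible ideals of $D$ (the zero ideal counts as non-invertible). $D$ is an MPD domain if it has a unique MNI ideal $Q$ and every nonzero non-invertible ideal of $D$ can be written as $JQ$ for some invertible ideal $J$ of $D$ (in particular, a Dedekind domain is an MPD domain with zero MNI ideal).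
   Formalization: D is additionally assumed not to be a field: a field satisfies the definition of an MPD domain (with zero MNI ideal) and has n = 1, but it has exactly one overring, so both (a) and (b) fail for it. *)

(* Defs.v *)
From HB Require Import structures.
From mathcomp Require Import all_boot all_order all_algebra.
From mathcomp Require Import all_classical.

Set Implicit Arguments.
Unset Strict Implicit.
Unset Printing Implicit Defensive.

Import GRing.Theory.
Local Open Scope classical_set_scope.
Local Open Scope ring_scope.

Section SubsetsOfARing.
Variable R : comNzRingType.

Definition is_subring (A : set R) : Prop := GRing.subring_closed (mem A).

(* Ideals are taken relative to a subring A of the ambient ring R, so that the
   same notion serves for D itself (A = [set: D]) and for the overrings of D,
   which are subsets of the quotient field.  The ideal A itself is allowed. *)
Definition is_ideal (A I : set R) : Prop :=
  [/\ I `<=` A, I 0,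
      forall x y, I x -> I y -> I (x + y)
    & forall a x, A a -> I x -> I (a * x)].

Definition is_maximal_ideal (A M : set R) : Prop :=
  [/\ is_ideal A M, M <> A
    & forall I, is_ideal A I -> M `<=` I -> I = M \/ I = A].

Definition Max (A : set R) : set (set R) := [set M | is_maximal_ideal A M].

Definition quasi_local (A : set R) : Prop := exists! M, Max A M.

(* The finite sums of products x * y with x in I and y in J. *)
Definition ideal_mul (I J : set R) : set R :=
  [set z | exists2 s : seq (R * R),
     (forall p, p \in s -> I p.1 /\ J p.2) & z = \sum_(p <- s) p.1 * p.2].

End SubsetsOfARing.

Section Domain.
Variable D : idomainType.

Notation K := {fraction D}.
Notation "x %:F" := (@FracField.tofrac D x).

Definition overrings : set (set K) :=
  [set A | is_subring A /\ range (@FracField.tofrac D) `<=` A].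

Definition ql_overrings : set (set K) :=
  [set A | overrings A /\ quasi_local A].

Definition ideal_of (I : set D) : Prop := is_ideal [set: D] I.

(* The fractional ideal (D : I) of the quotient field. *)
Definition ideal_inv (I : set D) : set K :=
  [set y | forall x, I x -> exists d, y * x%:F = d%:F].

(* I I^-1 = D, computed in the quotient field. *)
Definition invertible (I : set D) : Prop :=
  ideal_mul (@FracField.tofrac D @` I) (ideal_inv I)
  = range (@FracField.tofrac D).

Definition is_MNI (Q : set D) : Prop :=
  [/\ ideal_of Q, ~ invertible Q
    & forall I, ideal_of I -> ~ invertible I -> Q `<=` I -> I = Q].

Definition MPD_domain : Prop :=
  exists Q : set D,
    [/\ is_MNI Q,
        forall Q', is_MNI Q' -> Q' = Q
      & forall I, ideal_of I -> I <> [set 0] -> ~ invertible I ->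
          exists J, [/\ ideal_of J, invertible J & I = ideal_mul J Q]].

End Domain.

Arguments overrings : clear implicits.
Arguments ql_overrings : clear implicits.
Arguments MPD_domain : clear implicits.

(* Main.v *)
Require Import Defs.
From mathcomp Require Import all_boot all_order all_algebra.
From mathcomp Require Import all_classical.
From mathcomp Require Import ring.

Set Implicit Arguments.
Unset Strict Implicit.
Unset Printing Implicit Defensive.

Import GRing.Theory.
Local Open Scope classical_set_scope.
Local Open Scope ring_scope.

(** Localize D at its maximal ideals and work inside the quotient field K.

    An invertible ideal becomes principal in D_M, so every ideal of D_M is either
    principal or a multiple of Q_M.  Let V be a local ring with an ideal Q such
    that every ideal of V is principal or a multiple of Q, and let E = (Q : Q).
    Then the only overrings of V are V, E and K.  Two facts give this.  A ring
    between V and K with nonzero conductor in V is, up to scaling, an ideal of V,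
    and it is the ring of multipliers of that ideal, so it is V or E
    (fractional_overring).  And E is a valuation ring (multipliers_eq_valuation
    when E = V, multipliers_neq_valuation otherwise), which forces every overring
    other than K to have nonzero conductor (overring_cases).

    So each D_M has two or three overrings, all of them quasi-local.  There are
    three for at most one M (intermediate_at_most_one): if W lies strictly between
    D_N and K, the intersection A of W with the other localizations of D has a
    nonzero conductor and differs from D, so that some multiple of A has the form
    JQ with J invertible; localizing at M, where A becomes D_M, shows that Q_M is
    principal, which leaves no room for (Q_M : Q_M) between D_M and K.  A
    consequence is that D_M and D_N generate K when M and N are distinct
    (dloc_independent), since a ring generated by them and different from K would
    be strictly between each of them and K.

    Because the localizations are independent and finite in number, an overring of
    D amounts to a choice of one overring of each D_M; hence there are 2 ^ n or
    3 * 2 ^ (n - 1) of them (card_overrings).  A quasi-local overring contains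
    some D_M, and M is unique unless the overring is K; summing over M the number
    of overrings of D_M other than K, and adding K itself, gives n + 1 or n + 2
    (card_ql_overrings). *)

(** * Local rings and maximal ideals *)

Section Subrings.
Variable R : comNzRingType.
Implicit Types A V I M : set R.

Lemma is_subringP A : is_subring A <->
  [/\ A 1, forall x y, A x -> A y -> A (x - y)
         & forall x y, A x -> A y -> A (x * y)].
Proof.
split=> [[h1 hB hM]|[h1 hB hM]]; split.
- exact: set_mem.
- by move=> x y Ax Ay; apply: set_mem; apply: hB; exact: mem_set.
- by move=> x y Ax Ay; apply: set_mem; apply: hM; exact: mem_set.
- exact: mem_set.
- move=> x y /set_mem Ax /set_mem Ay; exact/mem_set/hB.
- move=> x y /set_mem Ax /set_mem Ay; exact/mem_set/hM.
Qed.

Section Closure.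
Variable A : set R.
Hypothesis hA : is_subring A.

Lemma subring1 : A 1. Proof. by case/is_subringP: hA. Qed.
Lemma subringB x y : A x -> A y -> A (x - y).
Proof. by case/is_subringP: hA => _ + _; apply. Qed.
Lemma subringM x y : A x -> A y -> A (x * y).
Proof. by case/is_subringP: hA => _ _; apply. Qed.
Lemma subring0 : A 0. Proof. by rewrite -(subrr 1); apply: subringB; exact: subring1. Qed.
Lemma subringN x : A x -> A (- x).
Proof. by move=> Ax; rewrite -sub0r; apply: subringB => //; exact: subring0. Qed.
Lemma subringD x y : A x -> A y -> A (x + y).
Proof. by move=> Ax Ay; rewrite -[y]opprK; apply: subringB => //; exact: subringN. Qed.
End Closure.

Definition has_inverse A u := exists2 v, A v & u * v = 1.

(** The elementwise form of having a single maximal ideal: after scaling, it says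
    that a sum of two non-units is never a unit. *)
Definition local A :=
  forall u v, A u -> A v -> u + v = 1 -> has_inverse A u \/ has_inverse A v.

Lemma has_inverseMl A u v : is_subring A -> A u -> has_inverse A (u * v) ->
  has_inverse A v.
Proof.
move=> hA Au [w Aw e]; exists (u * w); first exact: subringM.
by rewrite mulrCA mulrA.
Qed.

Lemma has_inverseMr A u v : is_subring A -> A v -> has_inverse A (u * v) ->
  has_inverse A u.
Proof. by rewrite mulrC; exact: has_inverseMl. Qed.

Lemma local3 A u v w : is_subring A -> local A -> A u -> A v -> A w ->
  u + v + w = 1 -> [\/ has_inverse A u, has_inverse A v | has_inverse A w].
Proof.
move=> hA lA Au Av Aw e.
have [[t At te]|] := lA _ _ (subringD hA Au Av) Aw e; last by constructor 3.
have [] := lA (u * t) (v * t) (subringM hA Au At) (subringM hA Av At).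
- by rewrite -mulrDl.
- by move/(has_inverseMr hA At); constructor 1.
- by move/(has_inverseMr hA At); constructor 2.
Qed.

Lemma local_quasi_local A : is_subring A -> local A -> quasi_local A.
Proof.
move=> hA lA; pose N := [set u | A u /\ ~ has_inverse A u].
have hN : is_ideal A N.
  split.
  - by move=> u [].
  - split; first exact: subring0.
    by move=> [v _ /eqP]; rewrite mul0r eq_sym oner_eq0.
  - move=> x y [Ax nx] [Ay ny]; split; first exact: subringD.
    move=> [v Av e].
    have [] := lA (x * v) (y * v) (subringM hA Ax Av) (subringM hA Ay Av).
    + by rewrite -mulrDl.
    + by move/(has_inverseMr hA Av).
    + by move/(has_inverseMr hA Av).
  - move=> a x Aa [Ax nx]; split; first exact: subringM.
    by move/(has_inverseMl hA Aa).
have N1 : ~ N 1 by move=> [_]; apply; exists 1; rewrite ?mulr1//; exact: subring1.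
have subN I : is_ideal A I -> I <> A -> I `<=` N.
  move=> [IA _ _ IM] nIA x Ix; split; first exact: IA.
  move=> [v Av e]; apply: nIA; apply/seteqP; split => // a Aa.
  by rewrite -[a]mulr1 -e [x * v]mulrC mulrA; apply: IM => //; exact: subringM.
exists N; split.
- split => //; first by move=> e; apply: N1; rewrite e; exact: subring1.
  move=> I hI NI; have [->|/(subN _ hI) IN] := pselect (I = A); first by right.
  by left; apply/seteqP.
- move=> M [hM MA maxM].
  by have [] := maxM N hN (subN _ hM MA) => // e; case: N1; rewrite e; exact: subring1.
Qed.

Lemma exists_maximal_ideal A I : is_subring A -> is_ideal A I -> ~ I 1 ->
  exists2 M, is_maximal_ideal A M & I `<=` M.
Proof.
move=> hA hI I1.
(* The empty set is admitted so that the union of the empty chain is. *)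
pose P (J : set R) := J = set0 \/ [/\ is_ideal A J, ~ J 1 & I `<=` J].
have chain (F : set (set R)) : F `<=` P -> total_on F subset ->
    P (\bigcup_(X in F) X).
  move=> FP Ftot.
  have [[J FJ [x0 Jx0]]|F0] := pselect (exists2 J, F J & J !=set0); last first.
    left; apply/seteqP; split => // x [J FJ Jx].
    by apply: F0; exists J => //; exists x.
  have good X x : F X -> X x -> [/\ is_ideal A X, ~ X 1 & I `<=` X].
    by move=> FX Xx; case: (FP _ FX) => // X0; rewrite X0 in Xx.
  right; split; last 1 first.
  - by move=> x Ix; exists J => //; case: (good _ _ FJ Jx0) => _ _; apply.
  - split.
    + by move=> x [X FX Xx]; case: (good _ _ FX Xx) => -[+ _ _ _] _ _; apply.
    + by exists J => //; case: (good _ _ FJ Jx0) => -[].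
    + move=> x y [X FX Xx] [Y FY Yy].
      have [XY|YX] := Ftot _ _ FX FY.
        by exists Y => //; case: (good _ _ FY Yy) => -[_ _ + _] _ _; apply => //; exact: XY.
      by exists X => //; case: (good _ _ FX Xx) => -[_ _ + _] _ _; apply => //; exact: YX.
    + move=> a x Aa [X FX Xx]; exists X => //.
      by case: (good _ _ FX Xx) => -[_ _ _ +] _ _; apply.
  - by move=> [X FX X1]; case: (good _ _ FX X1).
have [M [PM maxM]] := Zorn_bigcup chain.
have I0 : I 0 by case: hI.
have [M0|[hM M1 IM]] := PM.
  exfalso; apply: (maxM I); last by right; split.
  by rewrite M0; split=> // /(_ 0 I0).
exists M => //; split => //; first by move=> e; apply: M1; rewrite e; exact: subring1.
move=> J hJ MJ; have [J1|J1] := pselect (J 1).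
  right; case: hJ => JA _ _ hJ; apply/seteqP; split => // a Aa.
  by rewrite -[a]mulr1; exact: hJ.
left; apply: contrapT => nJM; apply: (maxM J).
  by split => // JM; apply: nJM; apply/seteqP.
by right; split => //; exact: subset_trans MJ.
Qed.

Lemma quasi_local_inverse A N : is_subring A -> quasi_local A ->
  is_maximal_ideal A N -> forall a, A a -> ~ N a -> has_inverse A a.
Proof.
move=> hA [N' [_ uN]] hN a Aa Na; apply: contrapT => ninv.
pose I := [set a * b | b in A].
have hI : is_ideal A I.
  split.
  - by move=> _ [b Ab <-]; exact: subringM.
  - by exists 0; rewrite ?mulr0//; exact: subring0.
  - by move=> _ _ [b Ab <-] [c Ac <-]; exists (b + c); rewrite ?mulrDr//; exact: subringD.
  - by move=> c _ Ac [b Ab <-]; exists (c * b); rewrite 1?mulrCA//; exact: subringM.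
have [|M hM IM] := exists_maximal_ideal hA hI.
  by move=> [b Ab e]; apply: ninv; exists b.
apply: Na; rewrite -(uN _ hN) (uN _ hM); apply: IM.
by exists 1; rewrite ?mulr1//; exact: subring1.
Qed.

End Subrings.

(** * Local rings whose ideals are principal or multiples of one ideal *)

Section LocalRing.
Variable K : fieldType.
Implicit Types V A I Q : set K.

Definition valuation_ring V := forall y, V y \/ V y^-1.

Definition multipliers Q := [set y : K | forall q, Q q -> Q (y * q)].

Lemma valuation_local V : is_subring V -> valuation_ring V -> local V.
Proof.
move=> hV vV u v Vu Vv e.
have [u0|u0] := eqVneq u 0.
  by right; exists 1; [exact: subring1|rewrite mulr1 -e u0 add0r].
have [v0|v0] := eqVneq v 0.
  by left; exists 1; [exact: subring1|rewrite mulr1 -e v0 addr0].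
have [h|h] := vV (v / u).
  left; exists (1 + v / u); first by apply: subringD => //; exact: subring1.
  by rewrite mulrDr mulr1 mulrCA divff// mulr1.
right; exists (1 + u / v).
  by apply: subringD; [|exact: subring1|rewrite -invf_div].
by rewrite mulrDr mulr1 mulrCA divff// mulr1 addrC.
Qed.

Lemma mulr1_neq0 (u v : K) : u * v = 1 -> u != 0.
Proof. by apply: contra_eq_neq => ->; rewrite mul0r eq_sym oner_neq0. Qed.

Lemma mulr1_invf (u v : K) : u * v = 1 -> u^-1 = v.
Proof.
by move=> e; apply: (mulfI (mulr1_neq0 e)); rewrite divff ?e// (mulr1_neq0 e).
Qed.

Variables V Q : set K.
Hypothesis hV : is_subring V.
Hypothesis lV : local V.
Hypothesis fracV : forall y, exists b, [/\ b != 0, V b & V (b * y)].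
Hypothesis idQ : is_ideal V Q.

Hypothesis idV : forall I, is_ideal V I ->
  exists2 c, V c & I = [set c * v | v in V] \/ I = [set c * q | q in Q].

Let E := multipliers Q.

Let V1 : V 1 := subring1 hV.
Let V0 : V 0 := subring0 hV.
Let VD x y : V x -> V y -> V (x + y). Proof. exact: subringD. Qed.
Let VB x y : V x -> V y -> V (x - y). Proof. exact: subringB. Qed.
Let VM x y : V x -> V y -> V (x * y). Proof. exact: subringM. Qed.
Let QV x : Q x -> V x. Proof. by case: idQ => + _ _ _; apply. Qed.
Let Q0 : Q 0. Proof. by case: idQ. Qed.
Let QD x y : Q x -> Q y -> Q (x + y). Proof. by case: idQ => _ _ + _; apply. Qed.
Let QM a x : V a -> Q x -> Q (a * x). Proof. by case: idQ => _ _ _; apply. Qed.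

Lemma multipliers_sub : V `<=` E.
Proof. by move=> v Vv q Qq; exact: QM. Qed.

Lemma multipliers_subring : is_subring E.
Proof.
apply/is_subringP; split.
- by move=> q; rewrite mul1r.
- move=> x y Ex Ey q Qq; rewrite mulrBl; apply: QD; first exact: Ex.
  by rewrite -mulN1r; apply: QM; [exact: subringN|exact: Ey].
- by move=> x y Ex Ey q Qq; rewrite -mulrA; apply: Ex; exact: Ey.
Qed.

Lemma stable_principal I c y : c != 0 -> I = [set c * v | v in V] ->
  (forall x, I x -> I (y * x)) -> V y.
Proof.
move=> c0 -> st; have [|v Vv e] := st c; first by exists 1; rewrite ?mulr1.
suff -> : y = v by [].
by apply: (mulfI c0); rewrite e mulrC.
Qed.

Lemma stable_multiple I c y : c != 0 -> I = [set c * v | v in Q] ->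
  (forall x, I x -> I (y * x)) <-> E y.
Proof.
move=> c0 ->; split=> [st q Qq|Ey _ [q Qq <-]].
  have [|q' Qq' e] := st (c * q); first by exists q.
  suff -> : y * q = q' by [].
  by apply: (mulfI c0); rewrite e mulrCA.
by exists (y * q); [exact: Ey|rewrite mulrCA].
Qed.

(** A ring A with nonzero conductor is, up to scaling, an ideal of V, and a ring
    is recovered from any of its nonzero ideals as the ring of multipliers. *)
Lemma fractional_overring A d : is_subring A -> V `<=` A -> d != 0 ->
  (forall a, A a -> V (d * a)) -> A = V \/ A = E.
Proof.
move=> hA VA d0 dA; pose I := [set d * a | a in A].
have hI : is_ideal V I.
  split.
  - by move=> _ [a Aa <-]; exact: dA.
  - by exists 0; rewrite ?mulr0//; exact: subring0.
  - by move=> _ _ [b Ab <-] [c Ac <-]; exists (b + c); rewrite ?mulrDr//; exact: subringD.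
  - by move=> c _ Vc [b Ab <-]; exists (c * b); rewrite 1?mulrCA//; apply: subringM => //; exact: VA.
have A_st a : A a <-> (forall x, I x -> I (a * x)).
  split=> [Aa _ [b Ab <-]|st]; first by exists (a * b); rewrite 1?mulrCA//; exact: subringM.
  have [|b Ab e] := st d; first by exists 1; rewrite ?mulr1//; exact: subring1.
  suff -> : a = b by [].
  by apply: (mulfI d0); rewrite e mulrC.
have Id : I d by exists 1; rewrite ?mulr1//; exact: subring1.
have [c Vc eI] := idV hI.
have c0 : c != 0.
  by apply: contra_neq d0 => c0; case: eI => eI; move: Id; rewrite eI => -[x _ <-]; rewrite c0 mul0r.
case: eI => eI.
  left; apply/seteqP; split => // a /A_st; exact: stable_principal eI.
by right; apply/seteqP; split => a; rewrite A_st (stable_multiple _ c0 eI).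
Qed.

(** Let N = V + yV.  If N or its square V + yV + y^2 V is principal, locality of V
    makes one of the displayed generators redundant, and then y or 1/y is in V.
    Otherwise N and its square are both multiples of Q, so N = JN for a multiple J
    of N; the elements of J are multipliers of N, hence of Q, and so lie in V.  As
    in Nakayama's lemma, locality then allows to divide by 1 - x for x in J unless
    J = V, in which case N is principal after all. *)
Lemma multipliers_eq_valuation : V = E -> valuation_ring V.
Proof.
move=> VE y.
have [[u Vu ue]|niy] := pselect (has_inverse V y).
  by right; rewrite (mulr1_invf ue).
have [b [b0 Vb Vby]] := fracV y.
have quot u w e : V w -> V e -> u * e = 1 -> y * u = w -> V y.
  by move=> Vw Ve ue yu; rewrite (_ : y = w * e); [exact: VM|rewrite -yu -mulrA ue mulr1].
have quotV u w e : V u -> V e -> w * e = 1 -> y * u = w -> V y^-1.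
  move=> Vu Ve we yu; rewrite (mulr1_invf (_ : y * (u * e) = 1)); first exact: VM.
  by rewrite mulrA yu.
pose I1 := [set z | exists s t, [/\ V s, V t & z = b * (s + t * y)]].
pose I2 := [set z | exists s t r, [/\ V s, V t, V r & z = b * b * (s + t * y + r * y * y)]].
have hI1 : is_ideal V I1.
  split.
  - move=> _ [s [t [Vs Vt ->]]]; rewrite (_ : _ * _ = b * s + b * y * t); last by ring.
    by apply: VD; exact: VM.
  - by exists 0, 0; split => //; ring.
  - move=> _ _ [s [t [Vs Vt ->]]] [s' [t' [Vs' Vt' ->]]]; exists (s + s'), (t + t').
    by split; [exact: VD|exact: VD|ring].
  - move=> a _ Va [s [t [Vs Vt ->]]]; exists (a * s), (a * t).
    by split; [exact: VM|exact: VM|ring].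
have hI2 : is_ideal V I2.
  split.
  - move=> _ [s [t [r [Vs Vt Vr ->]]]].
    rewrite (_ : _ * _ = b * b * s + b * (b * y) * t + (b * y) * (b * y) * r); last by ring.
    by apply: VD; [apply: VD|]; apply: VM => //; exact: VM.
  - by exists 0, 0, 0; split => //; ring.
  - move=> _ _ [s [t [r [Vs Vt Vr ->]]]] [s' [t' [r' [Vs' Vt' Vr' ->]]]].
    exists (s + s'), (t + t'), (r + r').
    by split; [exact: VD|exact: VD|exact: VD|ring].
  - move=> a _ Va [s [t [r [Vs Vt Vr ->]]]]; exists (a * s), (a * t), (a * r).
    by split; [exact: VM|exact: VM|exact: VM|ring].
have I1b : I1 b by exists 1, 0; split => //; ring.
have I1by : I1 (b * y) by exists 0, 1; split => //; ring.
have [c Vc [eI|eI]] := idV hI1.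
  move: I1b I1by; rewrite {1 2}eI => -[u Vu bu] [w Vw byw].
  have : I1 c by rewrite eI; exists 1; rewrite ?mulr1.
  move=> [s [t [Vs Vt ce]]].
  have c0 : c != 0 by apply: contra_neq b0 => c0; rewrite -bu c0 mul0r.
  have yu : y * u = w by apply: (mulfI c0); rewrite byw -bu; ring.
  have e1 : s * u + t * w = 1.
    by apply: (mulfI c0); rewrite mulrDr mulrCA bu mulrCA byw mulr1 [RHS]ce; ring.
  have [h|h] := lV (VM Vs Vu) (VM Vt Vw) e1.
    by left; case: (has_inverseMl hV Vs h) => e Ve ue; exact: quot ue yu.
  by right; case: (has_inverseMl hV Vt h) => e Ve ue; exact: quotV ue yu.
have c0 : c != 0.
  by apply: contra_neq b0 => c0; move: I1b; rewrite eI => -[q _ <-]; rewrite c0 mul0r.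
have I2b : I2 (b * b) by exists 1, 0, 0; split => //; ring.
have I2by : I2 (b * b * y) by exists 0, 1, 0; split => //; ring.
have I2byy : I2 (b * b * y * y) by exists 0, 0, 1; split => //; ring.
have bb0 : b * b != 0 by rewrite mulf_neq0.
have [h Vh [fI|fI]] := idV hI2.
  have : I2 h by rewrite fI; exists 1; rewrite ?mulr1.
  move: I2b I2by I2byy; rewrite {1 2 3}fI => -[u Vu bu] [w Vw bw] [z Vz bz].
  move=> [s [t [r [Vs Vt Vr he]]]].
  have h0 : h != 0 by apply: contra_neq bb0 => c0'; rewrite -bu c0' mul0r.
  have yu : y * u = w by apply: (mulfI h0); rewrite bw -bu; ring.
  have yw : y * w = z by apply: (mulfI h0); rewrite bz mulrCA bw; ring.
  have e1 : s * u + t * w + r * z = 1.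
    apply: (mulfI h0); rewrite !mulrDr mulrCA bu [h * (t * w)]mulrCA bw [h * (r * z)]mulrCA bz.
    by rewrite mulr1 [RHS]he; ring.
  have [g|g|g] := local3 hV lV (VM Vs Vu) (VM Vt Vw) (VM Vr Vz) e1.
  - by left; case: (has_inverseMl hV Vs g) => e Ve ue; exact: quot ue yu.
  - by right; case: (has_inverseMl hV Vt g) => e Ve ue; exact: quotV ue yu.
  - by right; case: (has_inverseMl hV Vr g) => e Ve ue; exact: quotV ue yw.
have h0 : h != 0.
  by apply: contra_neq bb0 => h0; move: I2b; rewrite fI => -[q _ <-]; rewrite h0 mul0r.
(* Here I1 = b N and I2 = b ^ 2 N ^ 2; so I2 = k I1 says N ^ 2 = (k / b) N. *)
pose k := h / c.
have kc : k * c = h by rewrite /k divfK.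
have k0 : k != 0 by rewrite mulf_neq0 ?invr_eq0.
have I12 z : I1 z <-> I2 (k * z).
  rewrite eI fI; split=> [[q Qq <-]|[q Qq e]].
    by exists q => //; rewrite mulrA kc.
  by exists q => //; apply: (mulfI k0); rewrite -e mulrA kc.
have I11 z x : I1 z -> I1 x -> I2 (z * x).
  move=> [s [t [Vs Vt ->]]] [s' [t' [Vs' Vt' ->]]].
  exists (s * s'), (s * t' + t * s'), (t * t').
  by split; [exact: VM|apply: VD; exact: VM|exact: VM|ring].
(* The elements i and j = y i of V generate J = (b / k) N. *)
have mult z : I1 z -> V (z / k).
  move=> I1z; rewrite VE -(stable_multiple _ c0 eI) => x I1x; apply/I12.
  by rewrite (_ : k * _ = z * x); [exact: I11|field].
pose i := b / k; pose j := b * y / k.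
have Vi : V i by exact: mult.
have Vj : V j by exact: mult.
have [s [t [r [Vs Vt Vr he]]]] : I2 (k * b) by apply/I12.
have e1 : (s * i + t * j) + r * j * y = 1.
  by apply: (mulfI (mulf_neq0 k0 b0)); rewrite mulr1 [RHS]he /i /j; field.
have ji : y * i = j by rewrite /i /j; field.
have [[e Ve ue]|ninv] := pselect (has_inverse V (s * i + t * j)).
  have e2 : (s * i * e) + (t * j * e) = 1 by rewrite -ue; ring.
  have [] := lV _ _ e2.
  - by apply: VM => //; exact: VM.
  - by apply: VM => //; exact: VM.
  - move/(has_inverseMr hV Ve)/(has_inverseMl hV Vs) => -[f Vf uf].
    by left; exact: quot uf ji.
  - move/(has_inverseMr hV Ve)/(has_inverseMl hV Vt) => -[f Vf uf].
    by right; exact: quotV uf ji.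
have Vm : V (1 - (s * i + t * j)) by apply: VB => //; apply: VD; exact: VM.
have [||//|[f Vf uf]] := lV _ Vm (_ : (s * i + t * j) + (1 - (s * i + t * j)) = 1).
- by apply: VD; exact: VM.
- by rewrite addrC subrK.
right; apply: (quotV (r * j) _ f (VM Vr Vj) Vf uf).
by rewrite -e1; ring.
Qed.


(** Here Q = xE for some x, and every nonzero E-stable ideal of V is a multiple of
    Q; so every ideal of E is generated by an element of V.  An element v of V
    outside Q is a unit of E: otherwise the ideal vV + Q, not being a multiple of
    Q, would be principal, say cV, and c would be a unit of E dividing v, with
    quotient a unit of the local ring V. *)
Lemma multipliers_neq_valuation q0 : Q q0 -> q0 != 0 -> V <> E -> valuation_ring E.
Proof.
move=> Qq0 q00 VnE.
have sE := multipliers_subring.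
have VE := multipliers_sub.
have stQ e q : E e -> Q q -> Q (e * q) by apply.
have stable I z : is_ideal V I -> (forall e x, E e -> I x -> I (e * x)) ->
    I z -> z != 0 -> exists c, [/\ V c, c != 0 & I = [set c * q | q in Q]].
  move=> hI st Iz z0; have [c Vc eI] := idV hI.
  have c0 : c != 0.
    by apply: contra_neq z0 => c0; case: eI => eI; move: Iz; rewrite eI => -[x _ <-]; rewrite c0 mul0r.
  case: eI => [eI|eI]; last by exists c.
  exfalso; apply: VnE; apply/seteqP; split => // e Ee.
  by apply: (stable_principal c0 eI) => x; exact: st.
have gen w : (forall e, E e -> V (w * e)) -> w != 0 ->
    exists c, [/\ V c, c != 0 & [set w * e | e in E] = [set c * q | q in Q]].
  move=> Vw w0; apply: (stable _ w) => //.
  - split.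
    + by move=> _ [e Ee <-]; exact: Vw.
    + by exists 0; rewrite ?mulr0//; exact: (subring0 sE).
    + by move=> _ _ [e Ee <-] [f Ef <-]; exists (e + f); rewrite ?mulrDr//; exact: (subringD sE).
    + by move=> a _ Va [e Ee <-]; exists (a * e); rewrite 1?mulrCA//; apply: (subringM sE) => //; exact: VE.
  - by move=> a _ Ea [e Ee <-]; exists (a * e); rewrite 1?mulrCA//; exact: (subringM sE).
  - by exists 1; rewrite ?mulr1//; exact: (subring1 sE).
have [d [Vd d0 ed]] : exists d, [/\ V d, d != 0 & [set q0 * e | e in E] = [set d * q | q in Q]].
  by apply: gen => // e Ee; apply: QV; rewrite mulrC; exact: stQ.
pose x := q0 / d.
have x0 : x != 0 by rewrite mulf_neq0 ?invr_eq0.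
have QxE : Q = [set x * e | e in E].
  apply/seteqP; split => [q Qq|_ [e Ee <-]].
    have : [set d * q | q in Q] (d * q) by exists q.
    by rewrite -ed => -[e Ee h]; exists e => //; apply: (mulfI d0); rewrite -h /x; field.
  have : [set q0 * e | e in E] (q0 * e) by exists e.
  rewrite ed => -[q Qq h]; suff -> : x * e = q by [].
  by apply: (mulfI d0); rewrite h /x; field.
have Qx : Q x by rewrite QxE; exists 1; rewrite ?mulr1//; exact: (subring1 sE).
have Q1 : ~ Q 1.
  move=> Q1; apply: VnE; apply/seteqP; split => // e Ee.
  by rewrite -[e]mulr1; apply: QV; exact: stQ.
have unitE v : V v -> ~ Q v -> has_inverse E v.
  move=> Vv Qv; pose J := [set z | exists s t, [/\ V s, Q t & z = v * s + t]].
  have hJ : is_ideal V J.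
    split.
    - by move=> _ [s [t [Vs Qt ->]]]; apply: VD; [exact: VM|exact: QV].
    - by exists 0, 0; split => //; ring.
    - move=> _ _ [s [t [Vs Qt ->]]] [s' [t' [Vs' Qt' ->]]]; exists (s + s'), (t + t').
      by split; [exact: VD|exact: QD|ring].
    - move=> a _ Va [s [t [Vs Qt ->]]]; exists (a * s), (a * t).
      by split; [exact: VM|exact: QM|ring].
  have Jv : J v by exists 1, 0; split => //; ring.
  have JQ q : Q q -> J q by exists 0, q; split => //; ring.
  have [c Vc [eJ|eJ]] := idV hJ; last first.
    by move: Jv; rewrite eJ => -[q Qq e]; case: Qv; rewrite -e; exact: QM.
  have c0 : c != 0.
    have v0 : v != 0 by apply/eqP => v0; apply: Qv; rewrite v0.
    by apply: contra_neq v0 => c0; move: Jv; rewrite eJ => -[w _ <-]; rewrite c0 mul0r.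
  pose Q' := [set z | Q (c * z)].
  have hQ' : is_ideal V Q'.
    split.
    - move=> z /JQ; rewrite eJ => -[w Vw e]; suff -> : z = w by [].
      exact: (mulfI c0).
    - by rewrite /Q' /= mulr0.
    - by move=> a b; rewrite /Q' /= mulrDr; exact: QD.
    - by move=> a b Va; rewrite /Q' /= mulrCA; exact: QM.
  have Q'x : Q' (x / c) by rewrite /Q' /= mulrC divfK.
  have [||g [Vg g0 eQ']] := stable _ _ hQ' _ Q'x.
  - by move=> e z Ee; rewrite /Q' /= mulrCA; exact: stQ.
  - by rewrite mulf_neq0 ?invr_eq0.
  have Q'Q z : Q' z -> Q z by rewrite eQ' => -[q Qq <-]; exact: QM.
  have : Q (x / c) by exact: Q'Q.
  rewrite QxE => -[c' Ec' xc].
  have cc' : c * c' = 1 by apply: (mulfI x0); rewrite mulrCA xc; field.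
  have : J c by rewrite eJ; exists 1; rewrite ?mulr1.
  move=> [s [t [Vs Qt ec]]].
  move: Jv; rewrite eJ => -[v' Vv' ev].
  have Qt' : Q (t / c) by apply: Q'Q; rewrite /Q' /= mulrC divfK.
  have e1 : s * v' + t / c = 1.
    by apply: (mulfI c0); rewrite mulr1 [RHS]ec -ev; field.
  have [h|[w Vw ew]] := lV (VM Vs Vv') (QV Qt') e1.
    have [w Vw ew] := has_inverseMl hV Vs h.
    exists (c' * w); first by apply: (subringM sE) => //; exact: VE.
    by rewrite -ev mulrACA cc' ew mulr1.
  by case: Q1; rewrite -ew mulrC; exact: QM.
have unitE' u : u != 0 -> E u -> ~ Q u -> has_inverse E u.
  move=> u0 Eu Qu.
  have [|| c [Vc c0 eu]] := gen (x * u).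
  - by move=> e Ee; rewrite -mulrA; apply: QV; rewrite mulrC; apply: stQ => //; exact: (subringM sE).
  - by rewrite mulf_neq0.
  have [e Ee he] : exists2 e, E e & u * e = c.
    have : [set c * q | q in Q] (c * x) by exists x.
    rewrite -eu => -[e Ee he]; exists e => //; apply: (mulfI x0); rewrite mulrA he; ring.
  have [f Ef hf] : exists2 f, E f & u = f * c.
    have : [set x * u * e | e in E] (x * u * 1) by exists 1 => //; exact: (subring1 sE).
    rewrite eu QxE => -[_ [f Ef <-] hf]; exists f => //; apply: (mulfI x0).
    by rewrite -[LHS]mulr1 -hf; ring.
  have Qc : ~ Q c by move=> Qc; apply: Qu; rewrite hf; exact: stQ.
  have [w Ew hw] := unitE c Vc Qc.
  by exists (e * w); [exact: (subringM sE)|rewrite mulrA he].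
move=> y; have [b [b0 Vb Vby]] := fracV y.
pose I := [set z | exists s t, [/\ E s, E t & z = x * b * (s + t * y)]].
have hI : is_ideal V I.
  split.
  - move=> _ [s [t [Es Et ->]]].
    rewrite (_ : _ * _ = b * (s * x) + b * y * (t * x)); last by ring.
    by apply: VD; apply: VM => //; apply: QV; exact: stQ.
  - by exists 0, 0; split; [exact: (subring0 sE)|exact: (subring0 sE)|ring].
  - move=> _ _ [s [t [Es Et ->]]] [s' [t' [Es' Et' ->]]]; exists (s + s'), (t + t').
    by split; [exact: (subringD sE)|exact: (subringD sE)|ring].
  - move=> a _ Va [s [t [Es Et ->]]]; exists (a * s), (a * t).
    by split; [apply: (subringM sE) => //; exact: VE|apply: (subringM sE) => //; exact: VE|ring].
have E1 : E 1 by exact: (subring1 sE).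
have E0 : E 0 by exact: (subring0 sE).
have Ib : I (x * b) by exists 1, 0; split => //; ring.
have Iby : I (x * b * y) by exists 0, 1; split => //; ring.
have [||c [Vc c0 eI]] := stable _ _ hI _ Ib.
- move=> a _ Ea [s [t [Es Et ->]]]; exists (a * s), (a * t).
  by split; [exact: (subringM sE)|exact: (subringM sE)|ring].
- by rewrite mulf_neq0.
have : I (c * x) by rewrite eI; exists x.
move: Ib Iby; rewrite {1 2}eI QxE.
move=> -[_ [u Eu <-] bu] [_ [w Ew <-] bw] [s [t [Es Et ec]]].
have cx0 : c * x != 0 by rewrite mulf_neq0.
have yu : y * u = w by apply: (mulfI cx0); rewrite -[RHS]mulrA bw mulrCA -(mulrA c) bu; ring.
have e1 : s * u + t * w = 1.
  apply: (mulfI cx0); rewrite mulr1 [RHS]ec.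
  have -> : c * x * (s * u + t * w) = s * (c * (x * u)) + t * (c * (x * w)) by ring.
  by rewrite bu bw; ring.
have u0 : u != 0.
  by apply: contra_neq (mulf_neq0 x0 b0) => u0; rewrite -bu u0 !mulr0.
have [Qu|/(unitE' _ u0 Eu)[e Ee ue]] := pselect (Q u); last first.
  by left; rewrite (_ : y = w * e); [exact: (subringM sE)|rewrite -yu -mulrA ue mulr1].
have [w0|w0] := eqVneq w 0.
  by case: Q1; rewrite -e1 w0 mulr0 addr0; exact: stQ.
have [Qw|/(unitE' _ w0 Ew)[e Ee we]] := pselect (Q w).
  by case: Q1; rewrite -e1; apply: QD; exact: stQ.
right; rewrite (mulr1_invf (_ : y * (u * e) = 1)); first exact: (subringM sE).
by rewrite mulrA yu.
Qed.

(** If 1/d lies outside A, comparing a with 1/d in the valuation ring E bounds the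
    denominators of all a in A; so A has nonzero conductor in V. *)
Lemma overring_cases q0 A : Q q0 -> q0 != 0 -> is_subring A -> V `<=` A ->
  A <> setT -> A <> V ->
  [/\ A = E, valuation_ring A
    & exists q, [/\ q != 0, V q & forall a, A a -> V (q * a)]].
Proof.
move=> Qq0 q00 hA VA AT AV.
have vE : valuation_ring E.
  have [VE|VE] := pselect (V = E).
    by rewrite -VE; exact: multipliers_eq_valuation.
  exact: multipliers_neq_valuation Qq0 q00 VE.
have EV e : E e -> V (q0 * e) by move=> Ee; rewrite mulrC; apply: QV; exact: Ee.
have [d [Vd d0 Ad]] : exists d, [/\ V d, d != 0 & ~ A d^-1].
  apply: contrapT => h; apply: AT; apply/seteqP; split => // y _.
  have [b [b0 Vb Vby]] := fracV y.
  rewrite -[y](mulKf b0); apply: subringM => //; last exact: VA.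
  by apply: contrapT => nA; apply: h; exists b.
have dA a : A a -> V (q0 * q0 * d * a).
  move=> Aa; have [->|a0] := eqVneq a 0; first by rewrite mulr0.
  have [/EV|/EV h] := vE (q0 * d * a); first by rewrite !mulrA.
  case: Ad; rewrite (_ : d^-1 = a * (q0 * (q0 * d * a)^-1)).
    by apply: subringM => //; exact: VA.
  by field; rewrite d0 a0.
have qd0 : q0 * q0 * d != 0 by rewrite !mulf_neq0.
have [//|AE] := fractional_overring hA VA qd0 dA.
split => //; first by rewrite AE.
by exists (q0 * q0 * d); split => //; apply: VM => //; apply: VM; exact: QV.
Qed.

End LocalRing.

(** * Localizations inside the quotient field *)

Section Localization.
Variable D : idomainType.

Notation K := {fraction D}.
Notation "x %:F" := (@FracField.tofrac D x).
Notation D_K := (range (@FracField.tofrac D)).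
Notation maximal M := (is_maximal_ideal [set: D] M).
Implicit Types (A B : set K) (M N I J Q : set D).

Lemma fraction_denominator (y : K) : exists a b, b != 0 /\ b%:F * y = a%:F.
Proof.
elim/quotW: y => x; exists (frac x).1, (frac x).2; split; first exact: denom_ratioP.
unlock FracField.tofrac; rewrite -[_ * _]FracField.pi_mul.
apply/eqmodP; rewrite /= FracField.equivfE /FracField.mulf.
by rewrite !numden_Ratio ?mul1r ?mulr1 ?oner_neq0 ?denom_ratioP// mulrC.
Qed.

Lemma tofrac_neq0 (d : D) : d != 0 -> d%:F != 0.
Proof. by rewrite tofrac_eq0. Qed.

Lemma tofrac_inj : injective (@FracField.tofrac D).
Proof. by move=> a b /eqP; rewrite tofrac_eq => /eqP. Qed.

Lemma overring_subring A : overrings D A -> is_subring A. Proof. by case. Qed.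

Lemma overring_tofrac A d : overrings D A -> A d%:F.
Proof. by case=> _; apply; exists d. Qed.

Lemma overring_base : overrings D D_K.
Proof.
split => //; apply/is_subringP; split.
- by exists 1; rewrite ?tofrac1.
- by move=> _ _ [a _ <-] [b _ <-]; exists (a - b); rewrite ?tofracB.
- by move=> _ _ [a _ <-] [b _ <-]; exists (a * b); rewrite ?tofracM.
Qed.

Lemma overring_setT : overrings D setT.
Proof. by split => //; apply/is_subringP. Qed.

Lemma setT_subring : is_subring [set: D].
Proof. exact/is_subringP. Qed.

Section MaximalIdeal.
Variable M : set D.
Hypothesis maxM : maximal M.

Lemma maximal0 : M 0. Proof. by case: maxM => -[]. Qed.
Lemma maximalD x y : M x -> M y -> M (x + y).
Proof. by case: maxM => -[_ _ + _] _ _; apply. Qed.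
Lemma maximalM a x : M x -> M (a * x).
Proof. by case: maxM => -[_ _ _ +] _ _ Mx; apply. Qed.

Lemma maximal_proper : ~ M 1.
Proof.
move=> M1; case: maxM => _ + _; apply; apply/seteqP; split => // x _.
by rewrite -[x]mulr1; exact: maximalM.
Qed.

Lemma maximal_comaximal s : ~ M s -> exists2 m, M m & exists r, 1 = m + s * r.
Proof.
move=> Ms; pose I := [set z | exists m r, M m /\ z = m + s * r].
have hI : is_ideal [set: D] I.
  split=> //.
  - by exists 0, 0; split; [exact: maximal0|rewrite mulr0 addr0].
  - move=> _ _ [m [r [Mm ->]]] [m' [r' [Mm' ->]]]; exists (m + m'), (r + r').
    by split; [exact: maximalD|ring].
  - move=> a _ _ [m [r [Mm ->]]]; exists (a * m), (a * r).
    by split; [exact: maximalM|ring].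
have MI : M `<=` I by move=> m Mm; exists m, 0; split => //; ring.
have Is : I s by exists 0, 1; split; [exact: maximal0|ring].
case: maxM => _ _ /(_ _ hI MI) [IM|IT]; first by case: Ms; rewrite -IM.
by have [m [r [Mm e]]] : I 1 by [rewrite IT]; exists m => //; exists r.
Qed.

Lemma maximal_prime s t : ~ M s -> ~ M t -> ~ M (s * t).
Proof.
move=> Ms Mt Mst; have [m Mm [r e]] := maximal_comaximal Ms.
apply: Mt; rewrite -[t]mulr1 e mulrDr mulrA [t * s]mulrC [s * t * r]mulrC.
by apply: maximalD; exact: maximalM.
Qed.

Lemma not_maximal_neq0 s : ~ M s -> s != 0.
Proof. by move=> Ms; apply/eqP => s0; apply: Ms; rewrite s0; exact: maximal0. Qed.

End MaximalIdeal.

(** The localization of the D-submodule A of the quotient field at the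
    complement of M. *)
Definition loc M A := [set y : K | exists2 s, ~ M s & A (s%:F * y)].

Definition dloc M := loc M D_K.

Lemma loc_mono M A B : A `<=` B -> loc M A `<=` loc M B.
Proof. by move=> AB y [s Ms As]; exists s => //; exact: AB. Qed.

Section LocalizationAt.
Variable M : set D.
Hypothesis maxM : maximal M.

Lemma sub_loc A : A `<=` loc M A.
Proof.
by move=> y Ay; exists 1; rewrite ?tofrac1 ?mul1r//; exact: maximal_proper.
Qed.

Lemma loc_overring A : overrings D A -> overrings D (loc M A).
Proof.
move=> oA; have hA := overring_subring oA; split; last first.
  by apply: subset_trans (sub_loc (A:=A)); case: oA.
apply/is_subringP; split.
- by apply: sub_loc; exact: subring1.
- move=> x y [s Ms As] [t Mt At]; exists (s * t); first exact: maximal_prime.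
  rewrite tofracM (_ : _ * _ = t%:F * (s%:F * x) - s%:F * (t%:F * y)); last by ring.
  by apply: subringB => //; apply: subringM => //; exact: overring_tofrac.
- move=> x y [s Ms As] [t Mt At]; exists (s * t); first exact: maximal_prime.
  by rewrite tofracM mulrACA; exact: subringM.
Qed.

Lemma dloc_overring : overrings D (dloc M).
Proof. exact: loc_overring overring_base. Qed.

Lemma dloc_inv s : ~ M s -> dloc M s%:F^-1.
Proof.
move=> Ms; exists s => //; exists 1 => //.
by rewrite tofrac1 divff// tofrac_neq0// (not_maximal_neq0 maxM).
Qed.

Lemma dloc_cancel A s y : is_subring A -> dloc M `<=` A -> ~ M s ->
  A (s%:F * y) -> A y.
Proof.
move=> hA VA Ms As; rewrite -[y](mulKf (x := s%:F)); last first.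
  by rewrite tofrac_neq0// (not_maximal_neq0 maxM).
by apply: subringM => //; apply: VA; exact: dloc_inv.
Qed.

Lemma loc_id A : is_subring A -> dloc M `<=` A -> loc M A = A.
Proof.
move=> hA VA; apply/seteqP; split; last exact: sub_loc.
by move=> y [s Ms]; exact: dloc_cancel.
Qed.

Lemma dloc_sub_loc A : overrings D A -> dloc M `<=` loc M A.
Proof. by case=> _ DA; exact: loc_mono. Qed.

Lemma dloc_local : local (dloc M).
Proof.
move=> u v [s Ms [a _ ea]] [t Mt [b _ eb]] e1.
have s0 : s%:F != 0 by rewrite tofrac_neq0// (not_maximal_neq0 maxM).
have t0 : t%:F != 0 by rewrite tofrac_neq0// (not_maximal_neq0 maxM).
have e : t * a + s * b = s * t.
  apply: tofrac_inj; rewrite tofracD !tofracM ea eb -[RHS]mulr1 -e1; ring.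
have inv (w : K) (r c : D) : ~ M r -> ~ M c -> c%:F = r%:F * w -> has_inverse (dloc M) w.
  move=> Mr Mc ec; exists (r%:F / c%:F).
    apply: subringM; [exact: (overring_subring dloc_overring)| |exact: dloc_inv].
    exact: overring_tofrac dloc_overring.
  have r0 : r%:F != 0 by rewrite tofrac_neq0// (not_maximal_neq0 maxM).
  have c0 : c%:F != 0 by rewrite tofrac_neq0// (not_maximal_neq0 maxM).
  by apply: (mulfI r0); rewrite mulrA -ec mulr1 mulrCA divff// mulr1.
have [Ma|Ma] := pselect (M a); last by left; exact: inv ea.
have [Mb|Mb] := pselect (M b); last by right; exact: inv eb.
case: (maximal_prime maxM Ms Mt); rewrite -e.
by apply: maximalD => //; exact: maximalM.
Qed.

Lemma dloc_fraction y : exists b, [/\ b != 0, dloc M b & dloc M (b * y)].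
Proof.
have [a [b [b0 e]]] := fraction_denominator y.
exists b%:F; split; first exact: tofrac_neq0.
  exact: overring_tofrac dloc_overring.
by rewrite e; exact: overring_tofrac dloc_overring.
Qed.

Lemma dloc_neqT : ~ GRing.field_axiom D -> dloc M <> setT.
Proof.
move=> nf VT; apply: nf => d d0; apply: contrapT => du.
have [Md|Md] := pselect (M d).
  have [s Ms [a _ e]] : dloc M (d%:F^-1) by rewrite VT.
  apply: Ms; rewrite (_ : s = a * d); first exact: maximalM.
  by apply: tofrac_inj; rewrite tofracM e divfK// tofrac_neq0.
have [m Mm [r e]] := maximal_comaximal maxM Md.
have [m0|m0] := eqVneq m 0.
  by apply: du; apply/unitrPr; exists r; rewrite e m0 add0r.
have [s Ms [a _ e']] : dloc M (m%:F^-1) by rewrite VT.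
apply: Ms; rewrite (_ : s = a * m); first exact: maximalM.
by apply: tofrac_inj; rewrite tofracM e' divfK// tofrac_neq0.
Qed.

Lemma dloc_sub_inj N : maximal N -> dloc M `<=` dloc N -> M = N.
Proof.
move=> maxN MN; have NM : N `<=` M.
  move=> x Nx; apply: contrapT => Mx.
  have [s Ns [a _ e]] := MN _ (dloc_inv Mx).
  apply: Ns; rewrite (_ : s = a * x); first exact: maximalM.
  apply: tofrac_inj; rewrite tofracM e divfK// tofrac_neq0//.
  exact: (not_maximal_neq0 maxM).
case: maxN => _ _ /(_ M) []//; first by case: maxM.
by move=> MT; case: (maximal_proper maxM); rewrite MT.
Qed.

Lemma loc_ideal I : ideal_of I ->
  is_ideal (dloc M) (loc M (@FracField.tofrac D @` I)).
Proof.
move=> [_ I0 ID IM]; split.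
- by move=> y [s Ms [a _ e]]; exists s => //; exists a.
- by apply: sub_loc; exists 0; rewrite ?tofrac0.
- move=> x y [s Ms [a Ia ea]] [t Mt [b Ib eb]]; exists (s * t); first exact: maximal_prime.
  exists (t * a + s * b); first by apply: ID; exact: IM.
  by rewrite tofracD !tofracM ea eb; ring.
- move=> x y [s Ms [a _ ea]] [t Mt [b Ib eb]]; exists (s * t); first exact: maximal_prime.
  exists (a * b); first by apply: IM.
  by rewrite !tofracM ea eb; ring.
Qed.

End LocalizationAt.

(** The denominators of y in A form an ideal of D, which by hypothesis lies in no
    maximal ideal. *)
Lemma overring_local_global A y : overrings D A ->
  (forall M, maximal M -> loc M A y) -> A y.
Proof.
move=> oA Ay; have hA := overring_subring oA.
pose I := [set d : D | A (d%:F * y)].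
have hI : is_ideal [set: D] I.
  split=> //.
  - by rewrite /I /= tofrac0 mul0r; exact: subring0.
  - by move=> a b Ia Ib; rewrite /I /= tofracD mulrDl; exact: subringD.
  - move=> a b _ Ib; rewrite /I /= tofracM -mulrA; apply: subringM => //.
    exact: overring_tofrac.
have [I1|I1] := pselect (I 1); first by rewrite -[y]mul1r -tofrac1.
have [M maxM IM] := exists_maximal_ideal setT_subring hI I1.
by have [s Ms As] := Ay _ maxM; case: Ms; exact: IM.
Qed.

Lemma common_denominator n (B : 'I_n -> set K) M y : maximal M ->
  (forall i, overrings D (B i)) -> (forall i, loc M (B i) y) ->
  exists2 s, ~ M s & forall i, B i (s%:F * y).
Proof.
move=> maxM oB By.
have /choice[s hs] : forall i, exists s, ~ M s /\ B i (s%:F * y).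
  by move=> i; have [s] := By i; exists s.
exists (\prod_i s i).
  apply: (big_ind (fun x => ~ M x)) => [|x z|i _]; last by case: (hs i).
    exact: maximal_proper.
  exact: maximal_prime.
move=> i; rewrite (bigD1 i)//= tofracM mulrAC mulrC; apply: subringM.
- exact: overring_subring (oB i).
- exact: overring_tofrac (oB i).
- by case: (hs i).
Qed.

(** A quasi-local overring contains D_M for any maximal ideal M of D containing
    the contraction of its maximal ideal. *)
Lemma quasi_local_sub_dloc A : ql_overrings D A ->
  exists2 M, maximal M & dloc M `<=` A.
Proof.
move=> [oA qA]; have hA := overring_subring oA.
have [N [maxN _]] := qA; have [[_ N0 ND NM] NA _] := maxN.
have N1 : ~ N 1.
  move=> N1; apply: NA; apply/seteqP; split; first by case: maxN => -[].
  by move=> a Aa; rewrite -[a]mulr1; exact: NM.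
pose I := [set d : D | N d%:F].
have hI : is_ideal [set: D] I.
  split=> //.
  - by move=> a b Ia Ib; rewrite /I /= tofracD; exact: ND.
  - by move=> a b _ Ib; rewrite /I /= tofracM; apply: NM => //; exact: overring_tofrac.
have [|M maxM IM] := exists_maximal_ideal setT_subring hI.
  by rewrite /I /= tofrac1.
exists M => // y [s Ms [a _ e]].
have [|v Av sv] := quasi_local_inverse hA qA maxN (overring_tofrac s oA).
  by move=> Ns; apply: Ms; exact: IM.
rewrite (_ : y = a%:F * v); last by rewrite e mulrAC sv mul1r.
by apply: subringM => //; exact: overring_tofrac.
Qed.

(** An invertible ideal becomes principal in D_M: if 1 is a sum of products x y
    with x in J and y in the inverse of J, one of these products is outside M. *)
Lemma invertible_locally_principal J M : maximal M -> invertible J ->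
  exists2 c, J c & forall j, J j -> exists s d, ~ M s /\ s * j = d * c.
Proof.
move=> maxM invJ; have : D_K 1 by exists 1; rewrite ?tofrac1.
rewrite -invJ => -[r hr e].
have [[p pr [s [Ms es]]]|np] := pselect (exists2 p, p \in r &
    exists s, ~ M s /\ p.1 * p.2 = s%:F).
  have [[c Jc ec] p2] := hr _ pr.
  exists c => // j Jj; have [d ed] := p2 _ Jj; exists s, d; split => //.
  by apply: tofrac_inj; rewrite !tofracM -es -ed -ec; ring.
have : exists2 m, M m & \sum_(p <- r) p.1 * p.2 = m%:F.
  elim: r hr np {e} => [|p r IH] hr np.
    by exists 0; [exact: maximal0|rewrite big_nil tofrac0].
  have [|[q qr hq]|m Mm em] := IH.
  - by move=> q qr; apply: hr; rewrite inE qr orbT.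
  - by apply: np; exists q => //; rewrite inE qr orbT.
  have [[c Jc ec] p2] := hr p (mem_head _ _).
  have [d ed] := p2 _ Jc.
  have Md : M d.
    apply: contrapT => Md; apply: np; exists p; first exact: mem_head.
    by exists d; split => //; rewrite -ed -ec mulrC.
  exists (d + m); first exact: maximalD.
  by rewrite big_cons em tofracD -ed -ec mulrC.
move=> [m Mm em]; move: Mm; rewrite (_ : m = 1); first by move/(maximal_proper maxM).
by apply: tofrac_inj; rewrite tofrac1 e em.
Qed.

Lemma ideal_mul_locally c J Q M z : maximal M -> ideal_of Q ->
  (forall j, J j -> exists s d, ~ M s /\ s * j = d * c) -> ideal_mul J Q z ->
  exists s q, [/\ ~ M s, Q q & s * z = c * q].
Proof.
move=> maxM [_ Q0 QD QM] Jc [r hr ->].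
elim: r hr => [|p r IH] hr.
  by exists 1, 0; rewrite big_nil !mulr0; split => //; exact: maximal_proper.
have [|s [q [Ms Qq e]]] := IH; first by move=> q qr; apply: hr; rewrite inE qr orbT.
have [Jp Qp] := hr p (mem_head _ _); have [t [d [Mt e']]] := Jc _ Jp.
exists (s * t), (s * d * p.2 + t * q); split.
- exact: maximal_prime.
- by apply: QD; exact: QM.
rewrite big_cons.
have -> : s * t * (p.1 * p.2 + \sum_(j <- r) j.1 * j.2) =
  s * (t * p.1) * p.2 + t * (s * \sum_(j <- r) j.1 * j.2) by ring.
by rewrite e e'; ring.
Qed.

Lemma invertible_multiplier I (y : K) : invertible I ->
  (forall i, I i -> exists2 i', I i' & y * i%:F = i'%:F) -> D_K y.
Proof.
move=> invI hy; have : D_K 1 by exists 1; rewrite ?tofrac1.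
rewrite -{1}invI => -[r hr e]; rewrite -[y]mulr1 e {e}.
have hD := overring_subring overring_base.
elim: r hr => [|p r IH] hr; first by rewrite big_nil mulr0; exact: subring0.
rewrite big_cons mulrDr; apply: subringD => //.
  have [[c Ic ec] p2] := hr p (mem_head _ _).
  have [c' Ic' ey] := hy _ Ic; have [d ed] := p2 _ Ic'.
  by exists d => //; rewrite -ed -ey -ec; ring.
by apply: IH => q qr; apply: hr; rewrite inE qr orbT.
Qed.

End Localization.

(** * Localizations of an MPD domain *)

Section MPD.
Variable D : idomainType.

Notation K := {fraction D}.
Notation "x %:F" := (@FracField.tofrac D x).
Notation D_K := (range (@FracField.tofrac D)).
Notation maximal M := (is_maximal_ideal [set: D] M).
Implicit Types (A B W : set K) (M N I J : set D).

Variable Q : set D.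
Hypothesis idQ : ideal_of Q.
Hypothesis mpdQ : forall I, ideal_of I -> I <> [set 0] -> ~ invertible I ->
  exists J, [/\ ideal_of J, invertible J & I = ideal_mul J Q].

Notation loc_ideal_of M I := (loc M (@FracField.tofrac D @` I)).

(** An ideal of D_M is generated by its contraction to D, which is invertible or
    of the form JQ with J invertible; and J becomes principal in D_M. *)
Lemma dloc_ideals M (maxM : maximal M) (I : set K) : is_ideal (dloc M) I ->
  exists2 c, dloc M c & I = [set c * v | v in dloc M]
    \/ I = [set c * q | q in loc_ideal_of M Q].
Proof.
move=> [IV I0 ID IM]; have oV := dloc_overring maxM; have hV := overring_subring oV.
pose C := [set d : D | I d%:F].
have hC : ideal_of C.
  split=> //.
  - by move=> a b Ca Cb; rewrite /C /= tofracD; exact: ID.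
  - by move=> a b _ Cb; rewrite /C /= tofracM; apply: IM => //; exact: overring_tofrac.
have IC y : I y <-> exists2 s, ~ M s & exists2 d, C d & d%:F = s%:F * y.
  split=> [Iy|[s Ms [d Cd e]]].
    have [s Ms [d _ e]] := IV _ Iy; exists s => //; exists d => //.
    by rewrite /C /= e; apply: IM => //; exact: overring_tofrac.
  rewrite -[y](mulKf (x := s%:F)) ?tofrac_neq0 ?(not_maximal_neq0 maxM)// -e.
  by apply: IM => //; exact: dloc_inv.
have [C0|C0] := pselect (C = [set 0]).
  exists 0; first exact: subring0.
  left; apply/seteqP; split => [y /IC[s Ms [d]]|_ [v _ <-]]; last by rewrite mul0r.
  rewrite C0 => -> /eqP; rewrite tofrac0 eq_sym mulf_eq0 tofrac_eq0.
  rewrite (negPf (not_maximal_neq0 maxM Ms)) /= => /eqP ->.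
  by exists 0; [exact: subring0|rewrite mulr0].
have [invC|ninvC] := pselect (invertible C).
  have [c Cc hc] := invertible_locally_principal maxM invC.
  exists c%:F; first exact: overring_tofrac.
  left; apply/seteqP; split => [y /IC[s Ms [d Cd e]]|_ [v Vv <-]]; last first.
    by rewrite mulrC; exact: IM.
  have [t [r [Mt e']]] := hc _ Cd.
  have Mts := maximal_prime maxM Mt Ms.
  have ts0 : (t * s)%:F != 0 by rewrite tofrac_neq0// (not_maximal_neq0 maxM).
  exists (r%:F / (t * s)%:F).
    by apply: subringM => //; [exact: overring_tofrac|exact: dloc_inv].
  have e2 : (t * s)%:F * y = r%:F * c%:F.
    by rewrite tofracM -mulrA -e -tofracM e' tofracM.
  by apply: (mulfI ts0); rewrite e2 [LHS]mulrC -mulrA divfK// mulrC.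
have [J [_ invJ eC]] := mpdQ hC C0 ninvC.
have [c Jc hc] := invertible_locally_principal maxM invJ.
exists c%:F; first exact: overring_tofrac.
right; apply/seteqP; split => [y /IC[s Ms [d Cd e]]|_ [v [s Ms [q Qq e]] <-]].
  have [|t [q [Mt Qq e']]] := ideal_mul_locally (z := d) maxM idQ hc; first by rewrite -eC.
  have Mts := maximal_prime maxM Mt Ms.
  have ts0 : (t * s)%:F != 0 by rewrite tofrac_neq0// (not_maximal_neq0 maxM).
  exists (q%:F / (t * s)%:F).
    by exists (t * s) => //; exists q => //; rewrite mulrCA divff// mulr1.
  have e2 : (t * s)%:F * y = c%:F * q%:F.
    by rewrite tofracM -mulrA -e -tofracM e' tofracM.
  by apply: (mulfI ts0); rewrite e2 [LHS]mulrC -mulrA divfK.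
apply/IC; exists s => //; exists (c * q).
  by rewrite eC; exists [:: (c, q)]; [move=> p; rewrite inE => /eqP ->|rewrite big_seq1].
by rewrite tofracM e mulrCA.
Qed.

Definition intermediate M W := [/\ overrings D W, dloc M `<=` W, W <> dloc M & W <> setT].

Lemma intermediate_structure M W : maximal M -> intermediate M W ->
  [/\ W = multipliers (loc_ideal_of M Q), valuation_ring W
    & exists q, [/\ q != 0, dloc M q & forall w, W w -> dloc M (q * w)]].
Proof.
move=> maxM [oW VW WV WT].
have hV := overring_subring (dloc_overring maxM).
have [[q Qq q0]|Q0] := pselect (exists2 q, loc_ideal_of M Q q & q != 0).
  exact: (overring_cases hV (dloc_local maxM) (dloc_fraction maxM)
    (loc_ideal maxM idQ) (dloc_ideals maxM) Qq q0 (overring_subring oW) VW WT WV).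
(* If Q = 0 then D_M is a principal ideal ring, so D_M itself may replace Q. *)
have idV : is_ideal (dloc M) (dloc M).
  split => //; [exact: subring0|exact: subringD|exact: subringM].
have idlV (I : set K) : is_ideal (dloc M) I -> exists2 c, dloc M c &
    I = [set c * v | v in dloc M] \/ I = [set c * v | v in dloc M].
  move=> /(dloc_ideals maxM)[c Vc [->|->]]; first by exists c => //; left.
  exists 0; first exact: subring0.
  left; apply/seteqP; split => [_ [q Qq <-]|_ [v _ <-]].
    have -> : q = 0 by apply: contrapT => /eqP q0; apply: Q0; exists q.
    by exists 0; [exact: subring0|rewrite !mulr0].
  by exists 0; [case: (loc_ideal maxM idQ)|rewrite mulr0 mul0r].
have [WE _ _] := overring_cases hV (dloc_local maxM) (dloc_fraction maxM) idV idlV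
  (subring1 hV) (oner_neq0 _) (overring_subring oW) VW WT WV.
case: WV; rewrite WE; apply/seteqP; split => [w Ew|]; last exact: multipliers_sub.
by rewrite -[w]mulr1; apply: Ew; exact: subring1.
Qed.

Lemma intermediate_unique M W W' : maximal M -> intermediate M W ->
  intermediate M W' -> W = W'.
Proof.
by move=> maxM /(intermediate_structure maxM)[-> _ _] /(intermediate_structure maxM)[-> _ _].
Qed.

Variables (n : nat) (e : 'I_n -> set D).
Hypothesis max_e : forall i, maximal (e i).
Hypothesis e_onto : forall M, maximal M -> exists i, M = e i.

(** Let A be the intersection of W with the D_P for P different from N.  It has a
    nonzero conductor aA in D because W has one in D_N.  As A localizes to W at N,
    it is not D, so aA = JQ.  But A localizes to D_M at M, so Q becomes principal
    in D_M, and then D_M has no overring of multipliers between D_M and K. *)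
Lemma intermediate_at_most_one M N W W' : maximal M -> maximal N -> M <> N ->
  intermediate N W -> intermediate M W' -> False.
Proof.
move=> maxM maxN MN iW iW'; have [oW VW WV WT] := iW.
have [_ _ [q [q0 [s Ns [a _ ea]] qW]]] := intermediate_structure maxN iW.
have oV P : maximal P -> overrings D (dloc P) by exact: dloc_overring.
have s0 : s%:F != 0 by rewrite tofrac_neq0// (not_maximal_neq0 maxN).
have a0 : a%:F != 0 by rewrite ea mulf_neq0.
have aW w : W w -> dloc N (a%:F * w).
  move=> Ww; rewrite ea -mulrA; apply: (subringM (overring_subring (oV _ maxN))).
    exact: overring_tofrac (oV _ maxN).
  exact: qW.
pose B i := if pselect (e i = N) then W else dloc (e i).
have oB i : overrings D (B i) by rewrite /B; case: pselect => eN //=; exact: oV.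
pose A := [set y | forall i, B i y].
have ADF d y : A y -> A (d%:F * y).
  move=> Ay i; apply: (subringM (overring_subring (oB i))); last exact: Ay.
  exact: overring_tofrac (oB i).
have Aloc P : maximal P -> P <> N -> A `<=` dloc P.
  move=> maxP PN y Ay; have [i ei] := e_onto maxP.
  by move: (Ay i); rewrite /B; case: pselect => eN /=; [case: PN; rewrite ei|rewrite ei].
have AW : A `<=` W.
  move=> y Ay; have [i ei] := e_onto maxN.
  by move: (Ay i); rewrite /B; case: pselect => // eN; case: eN.
have aA y : A y -> D_K (a%:F * y).
  move=> Ay; apply: (overring_local_global (overring_base D)) => P maxP.
  have [->|PN] := pselect (P = N); first by apply: aW; exact: AW.
  exact: (Aloc _ maxP PN _ (ADF _ _ Ay)).
pose I := [set d : D | A (d%:F / a%:F)].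
have A1 : A 1 by move=> i; exact: subring1 (overring_subring (oB i)).
have A0 : A 0 by move=> i; exact: subring0 (overring_subring (oB i)).
have hI : ideal_of I.
  split=> //.
  - by rewrite /I /= tofrac0 mul0r.
  - move=> x y Ix Iy; rewrite /I /= tofracD mulrDl => i.
    by apply: (subringD (overring_subring (oB i))); [exact: Ix|exact: Iy].
  - by move=> x y _ Iy; rewrite /I /= tofracM -mulrA; exact: ADF.
have Ia : I a by rewrite /I /= divff.
have I0 : I <> [set 0].
  by move=> I0; move: Ia a0; rewrite I0 => ->; rewrite tofrac0 eqxx.
have [y [Wy Vy]] : exists y, W y /\ ~ dloc N y.
  apply: contrapT => h; apply: WV; apply/seteqP; split => // y Wy.
  by apply: contrapT => Vy; apply: h; exists y.
have [t Nt At] : loc N A y.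
  apply: (common_denominator maxN oB) => i; rewrite /B; case: pselect => eN /=.
    exact: sub_loc.
  have oC := loc_overring maxN (oV _ (max_e i)).
  have VC := dloc_sub_loc (M := N) (oV _ (max_e i)).
  have [-> //|CT] := pselect (loc N (dloc (e i)) = setT).
  suff <- : W = loc N (dloc (e i)) by [].
  apply: (intermediate_unique maxN iW); split => // CV.
  apply: eN; apply: dloc_sub_inj => //; rewrite -[X in _ `<=` X]CV; exact: sub_loc.
have ninvI : ~ invertible I.
  move=> invI; apply: Vy; exists t => //.
  apply: (invertible_multiplier invI) => i Ii.
  have Aty : A (t%:F * y * (i%:F / a%:F)).
    by move=> k; apply: (subringM (overring_subring (oB k))); [exact: At|exact: Ii].
  have [i' _ ei'] := aA _ Aty.
  have ei : t%:F * y * i%:F = i'%:F by rewrite ei' mulrCA [a%:F * _]mulrC divfK.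
  by exists i' => //; rewrite /I /= -ei -mulrA.
have [J [_ invJ eI]] := mpdQ hI I0 ninvI.
have [c Jc hc] := invertible_locally_principal maxM invJ.
have [|r [q' [Mr Qq' er]]] := ideal_mul_locally (z := a) maxM idQ hc; first by rewrite -eI.
have [_ VW' WV' _] := iW'.
have [WE' _ _] := intermediate_structure maxM iW'.
apply: WV'; apply/seteqP; split => // w; rewrite WE' => Ew.
have [|u Mu [p Qp ep]] := Ew q'%:F; first by apply: sub_loc => //; exists q'.
have Icp : I (c * p).
  by rewrite eI; exists [:: (c, p)]; [move=> x; rewrite inE => /eqP ->|rewrite big_seq1].
have hV := overring_subring (oV _ maxM).
apply: (dloc_cancel maxM hV (s := r)) => //.
apply: (dloc_cancel maxM hV (s := u)) => //.
rewrite (_ : _ * _ = (c * p)%:F / a%:F); first exact: (Aloc _ maxM MN).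
apply: (mulIf a0); rewrite divfK// tofracM ep.
have er' : r%:F * a%:F = c%:F * q'%:F by rewrite -!tofracM er.
have -> : u%:F * (r%:F * w) * a%:F = u%:F * (w * (r%:F * a%:F)) by ring.
rewrite er'. by ring.
Qed.

Lemma dloc_independent M N : maximal M -> maximal N -> M <> N ->
  loc N (dloc M) = setT.
Proof.
move=> maxM maxN MN; apply: contrapT => CT.
have oM := dloc_overring maxM; have oN := dloc_overring maxN.
have oC := loc_overring maxN oM.
have NC := dloc_sub_loc (M := N) oM; have MC := sub_loc maxN (A := dloc M).
apply: (intermediate_at_most_one maxM maxN MN (W := loc N (dloc M)) (W' := loc N (dloc M))).
- split => // CN; apply: MN; apply: dloc_sub_inj => //; rewrite -[X in _ `<=` X]CN.
  exact: sub_loc.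
- split => // CM; apply: MN; apply/esym/dloc_sub_inj => //; rewrite -[X in _ `<=` X]CM.
  exact: NC.
Qed.

End MPD.

(** * Counting overrings *)

Lemma card_eq_finType (T : finType) (U : Type) (S : set U) (f : T -> U) :
  injective f -> (forall t, S (f t)) -> (forall u, S u -> exists t, u = f t) ->
  (S #= `I_#|T|)%card.
Proof.
move=> injf fS Sf; have -> : S = (f \o @enum_val T T) @` setT.
  apply/seteqP; split => [u /Sf[t ->]|_ [i _ <-]]; last exact: fS.
  by exists (enum_rank t) => //=; rewrite enum_rankK.
apply: card_eq_trans; last by apply: card_esym; exact: card_II.
apply: inj_card_eq => i j _ _ /injf; exact: enum_val_inj.
Qed.

Section IndependentLocalizations.
Variable D : idomainType.

Notation K := {fraction D}.
Notation maximal M := (is_maximal_ideal [set: D] M).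

Variables (n : nat) (e : 'I_n -> set D).
Hypothesis max_e : forall i, maximal (e i).
Hypothesis e_onto : forall M, maximal M -> exists i, M = e i.
Hypothesis indep : forall i j, i != j -> loc (e j) (dloc (e i)) = setT.

(** L i lists, without repetition, the c i overrings of the localization at e i,
    starting with the quotient field. *)
Variables (c : 'I_n -> nat) (L : 'I_n -> nat -> set K).
Hypothesis c_gt0 : forall i, (0 < c i)%N.
Hypothesis L0 : forall i, L i 0 = setT.
Hypothesis L_overring : forall i k, (k < c i)%N -> overrings D (L i k).
Hypothesis L_dloc : forall i k, (k < c i)%N -> dloc (e i) `<=` L i k.
Hypothesis L_inj : forall i k l, (k < c i)%N -> (l < c i)%N -> L i k = L i l -> k = l.
Hypothesis L_onto : forall i A, overrings D A -> dloc (e i) `<=` A ->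
  exists2 k, (k < c i)%N & A = L i k.

Lemma loc_L_neq i j k : i != j -> (k < c i)%N -> loc (e j) (L i k) = setT.
Proof.
move=> ij kc; apply/seteqP; split => // y _; have := loc_mono (L_dloc kc).
by move/(_ (e j) y); apply; rewrite indep.
Qed.

Lemma loc_L_eq i k : (k < c i)%N -> loc (e i) (L i k) = L i k.
Proof.
by move=> kc; apply: loc_id => //; [exact: overring_subring (L_overring kc)|exact: L_dloc].
Qed.

(** Localization commutes with finite intersections, and by independence only the
    j-th component survives the localization at e j; so the localizations of an
    overring can be prescribed arbitrarily, and they determine it. *)
Lemma card_overrings : (overrings D #= `I_(\prod_i c i))%card.
Proof.
pose T := {dffun forall i, 'I_(c i)}.
have cT : #|{: T}| = (\prod_i c i)%N.
  rewrite card_dep_ffun foldrE big_map big_enum.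
  by apply: eq_bigr => i _; rewrite card_ord.
pose G (f : T) : set K := [set y | forall i, L i (f i) y].
have oG f : overrings D (G f).
  split; last first.
    by move=> _ [d _ <-] i; exact: overring_tofrac (L_overring (ltn_ord _)).
  apply/is_subringP; split.
  - by move=> i; exact: subring1 (overring_subring (L_overring (ltn_ord (f i)))).
  - move=> x y Gx Gy i.
    by apply: (subringB (overring_subring (L_overring (ltn_ord (f i))))); [exact: Gx|exact: Gy].
  - move=> x y Gx Gy i.
    by apply: (subringM (overring_subring (L_overring (ltn_ord (f i))))); [exact: Gx|exact: Gy].
have locG f j : loc (e j) (G f) = L j (f j).
  apply/seteqP; split => [y [s Ms Gs]|y Ly].
    rewrite -(loc_L_eq (ltn_ord (f j))); exists s => //; exact: Gs.
  apply: (common_denominator (max_e j) (B := fun i => L i (f i))) => i.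
    exact: L_overring.
  by have [->|ij] := eqVneq i j; [rewrite loc_L_eq|rewrite loc_L_neq].
rewrite -cT; apply: (card_eq_finType (f := G)) => // [f g fg|A oA].
  apply/ffunP => i; apply: val_inj; apply: (@L_inj i) => //=.
  by rewrite -!locG fg.
have Lk i : exists k : 'I_(c i), loc (e i) A = L i k.
  have [k kc ek] := L_onto (loc_overring (max_e i) oA) (dloc_sub_loc oA).
  by exists (Ordinal kc).
pose k i := sval (cid (Lk i)); have hk i : loc (e i) A = L i (k i) := svalP (cid (Lk i)).
exists [ffun i => k i]; apply/seteqP; split => [y Ay i|y Gy].
  by rewrite ffunE -hk; exact: sub_loc.
apply: overring_local_global => // M /e_onto[i ->].
by rewrite hk; have := Gy i; rewrite ffunE.
Qed.

(** A quasi-local overring contains some localization of D, which by independence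
    is unique unless the overring is the quotient field. *)
Lemma card_ql_overrings : (forall i k, (k < c i)%N -> local (L i k)) ->
  (ql_overrings D #= `I_(\sum_i (c i).-1).+1)%card.
Proof.
move=> L_local; pose T := {i : 'I_n & 'I_(c i).-1}.
have cT : #|{: option T}| = (\sum_i (c i).-1).+1.
  rewrite card_option card_tagged sumnE big_map big_enum.
  by congr _.+1; apply: eq_bigr => i _; rewrite card_ord.
have kc i (k : 'I_(c i).-1) : (k.+1 < c i)%N.
  by rewrite -[X in (_ < X)%N](prednK (c_gt0 i)) ltnS.
pose F (t : option T) : set K := if t is Some u then L (tag u) (tagged u).+1 else setT.
have FT u : F (Some u) <> setT.
  by rewrite -(L0 (tag u)) => /L_inj; rewrite kc c_gt0 => /(_ isT isT).
have ql i k : (k < c i)%N -> ql_overrings D (L i k).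
  move=> lk; split; first exact: L_overring.
  by apply: local_quasi_local; [exact: overring_subring (L_overring lk)|exact: L_local].
rewrite -cT; apply: (card_eq_finType (f := F)).
- move=> [u|] [v|] // uv; last by case: (FT v).
    case: u v uv => [i k] [j l] /= kl; have [ij|ij] := eqVneq i j.
      rewrite -{j}ij in l kl *; congr (Some (Tagged (fun i => 'I_(c i).-1) _)).
      by apply: val_inj; apply/eq_add_S; exact: (L_inj (kc _ _) (kc _ _) kl).
    case: (FT (Tagged (fun i => 'I_(c i).-1) l)); rewrite -(loc_L_neq ij (kc _ k)).
    by rewrite kl loc_L_eq.
  by case: (FT u).
- case=> [u|]; first exact: ql.
  split; first exact: overring_setT.
  have hT := overring_subring (overring_setT D).
  by apply: local_quasi_local => //; apply: valuation_local => // y; left.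
- move=> A qA; have [oA _] := qA; have [M /e_onto[i ->] VA] := quasi_local_sub_dloc qA.
  have [[|k] lk ->] := L_onto oA VA; first by exists None; rewrite L0.
  have lk' : (k < (c i).-1)%N by rewrite -ltnS prednK.
  by exists (Some (Tagged (fun i => 'I_(c i).-1) (Ordinal lk'))).
Qed.

End IndependentLocalizations.

Local Close Scope ring_scope.
Local Open Scope card_scope.

Theorem theorem11 (D : idomainType) (n : nat)
    (hnf : ~ GRing.field_axiom D)
    (hD : MPD_domain D)
    (hn : Max [set: D] #= `I_n) :
  (overrings D #= `I_(2 ^ n) \/ overrings D #= `I_(3 * 2 ^ (n - 1))) /\
  (ql_overrings D #= `I_(n + 2) \/ ql_overrings D #= `I_(n + 1)).
Proof.
have [Q [[idQ _ _] _ mpdQ]] := hD.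
have [e [max_e e_inj e_onto]] : exists e : 'I_n -> set D,
    [/\ forall i, Max [set: D] (e i), injective e
      & forall M, Max [set: D] M -> exists i, M = e i].
  have : ([set: 'I_n] #= Max [set: D])%card.
    rewrite card_eq_sym; exact: card_eq_trans hn card_II.
  move=> /card_set_bijP[e [maxe e_inj e_surj]]; exists e; split.
  - by move=> i; exact: maxe.
  - by move=> i j; apply: e_inj; rewrite inE.
  - by move=> M /e_surj[i _ <-]; exists i.
pose three i := exists W, intermediate (e i) W.
pose c i := if `[< three i >] then 3 else 2.
pose L i k : set {fraction D} := match k with
  0 => setT | 1 => dloc (e i) | _ => xget setT (intermediate (e i)) end.
have LW i : three i -> intermediate (e i) (L i 2) by move=> h; exact: xgetPex.
have small i k : (k < c i)%N -> [\/ k = 0, k = 1 | k = 2 /\ three i].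
  rewrite /c; case: asboolP => h.
    by case: k => [|[|[|k]]] // _; [constructor 1|constructor 2|constructor 3].
  by case: k => [|[|k]] // _; [constructor 1|constructor 2].
have c_gt0 i : (0 < c i)%N by rewrite /c; case: ifP.
have ne i j : i != j -> e i <> e j by move=> /eqP ij /e_inj.
have indep i j : i != j -> loc (e j) (dloc (e i)) = setT.
  by move=> /ne ij; exact: (dloc_independent idQ mpdQ max_e e_onto (max_e i) (max_e j) ij).
have L_overring i k : (k < c i)%N -> overrings D (L i k).
  move=> /small[->|->|[-> /LW[]]] //; first exact: overring_setT.
  exact: (dloc_overring (max_e i)).
have L_dloc i k : (k < c i)%N -> dloc (e i) `<=` L i k.
  by move=> /small[->|->|[-> /LW[]]].
have L01 i : dloc (e i) <> setT by exact: (dloc_neqT (max_e i) hnf).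
have L_inj i k l : (k < c i)%N -> (l < c i)%N -> L i k = L i l -> k = l.
  move=> /small[->|->|[-> /LW[_ _ n1 n0]]] /small[->|->|[-> /LW[_ _ m1 m0]]] // E.
  - by case: (L01 i); exact: esym E.
  - by case: m0; exact: esym E.
  - by case: (L01 i); exact: E.
  - by case: m1; exact: esym E.
have L_onto i A : overrings D A -> dloc (e i) `<=` A ->
    exists2 k, (k < c i)%N & A = L i k.
  move=> oA VA; have [->|A0] := pselect (A = setT); first by exists 0.
  have [->|A1] := pselect (A = dloc (e i)).
    by exists 1 => //; rewrite /c; case: ifP.
  have iA : intermediate (e i) A by [].
  have ti : three i by exists A.
  exists 2; first by rewrite /c; case: asboolP.
  exact: (intermediate_unique idQ mpdQ (max_e i) iA (LW _ ti)).
have L_local i k : (k < c i)%N -> local (L i k).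
  move=> ki; have hL := overring_subring (L_overring _ _ ki).
  have [k0|k1|[k2 ti]] := small _ _ ki.
  - by apply: valuation_local => // y; left; rewrite k0.
  - by rewrite k1; exact: (dloc_local (max_e i)).
  - apply: valuation_local => //; rewrite k2.
    by have [] := intermediate_structure idQ mpdQ (max_e i) (LW _ ti).
have ov := card_overrings max_e e_onto indep L_overring L_dloc L_inj L_onto.
have ql := card_ql_overrings max_e e_onto indep c_gt0 (fun i => erefl)
  L_overring L_dloc L_inj L_onto L_local.
have [[i ti]|no] := pselect (exists i, three i).
  have c2 j : j != i -> c j = 2.
    move=> ji; rewrite /c; case: asboolP => // -[W iW]; case: ti => W' iW'.
    have ij : e i <> e j by apply: ne; rewrite eq_sym.
    by case: (intermediate_at_most_one idQ mpdQ max_e e_onto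
      (max_e i) (max_e j) ij iW iW').
  have c3 : c i = 3 by rewrite /c; case: asboolP.
  have cn : #|predC1 i| = n.-1 by rewrite cardC1 card_ord.
  split; [right|left].
    rewrite (bigD1 i)//= c3 (eq_bigr (fun _ => 2)) // prod_nat_const in ov.
    by rewrite subn1 -cn.
  rewrite (bigD1 i)//= c3 (eq_bigr (fun _ => 1)) in ql; last by move=> j /c2 ->.
  rewrite sum_nat_const [#|_|]cn muln1 add2n in ql.
  by rewrite addn2 -(ltn_predK (ltn_ord i)).
have c2 i : c i = 2 by rewrite /c; case: asboolP => // h; case: no; exists i.
split; [left|right].
  by rewrite (eq_bigr (fun _ => 2)) // prod_nat_const card_ord in ov.
rewrite (eq_bigr (fun _ => 1)) in ql; last by move=> j _; rewrite c2.
by rewrite sum_nat_const card_ord muln1 -addn1 in ql.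
Qed.
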